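(* Let a representation of the Weyl algebra on a complex vector space be given in which $X^2$ and $R=X^2-1$ act as injective operators. For $n,\ell\in\mathbb R$ put $$H_{n\ell}=RD^2+(\ell+1)XD-n(n+\ell),\qquad U_{n\ell}=\ker H_{n\ell}.$$ Then the Legendre–Gegenbauer grid, with vertex spaces $U_{n\ell}$ and arrows - East: $(n+\ell)X+RD:\ U_{n\ell}\to U_{n+1,\ell}$, - West: $nX-RD:\ U_{n\ell}\to U_{n-1,\ell}$, - North: $XD+n+\ell:\ U_{n\ell}\to U_{n,\ell+2}$, - South: $R(XD-n)+\ell-1:\ U_{n\ell}\to U_{n,\ell-2}$, - Northwest: $D:\ U_{n\ell}\to U_{n-1,\ell+2}$, - Southeast: $(\ell-1)X+RD:\ U_{n\ell}\to U_{n+1,\ell-2}$, is a well defined SIE grid: each listed operator maps the stated source space into the stated target space, and every circuit endomorphism of the grid is a scalar multiple of the identity. Moreover the following circuit endomorphisms $U_{n\ell}\to U_{n\ell}$ act as the stated scalars. Narrow circuits: - East: $[(n+1)X-RD]\,[(n+\ell)X+RD]=(n+1)(n+\ell)$; - West: $[(n+\ell-1)X+RD]\,[nX-RD]=n(n+\ell-1)$; - North: $[R(XD-n)+(\ell+1)]\,(XD+n+\ell)=(n+\ell)(n+\ell+1)$; - South: $(XD+n+\ell-2)\,[R(XD-n)+(\ell-1)]=(n+\ell-2)(n+\ell-1)$; - Northwest: $[(\ell+1)X+RD]\,D=n(n+\ell)$; - Southeast: $D\,[(\ell-1)X+RD]=(n+1)(n+\ell-1)$. Triangle circuits: - North–Northwest: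 $[(\ell+1)X+RD]\,(nX-RD)\,(XD+n+\ell)=n(n+\ell)(n+\ell+1)$; - Northwest–North: $[R(XD-n)+\ell+1]\,[(n+\ell+1)X+RD]\,D=n(n+\ell)(n+\ell+1)$; - Northwest–West: $[(n+\ell-1)X+RD]\,[R(XD-n+1)+\ell+1]\,D=n(n+\ell-1)(n+\ell)$; - West–Northwest: $[(\ell+1)X+RD]\,(XD+n+\ell-1)\,(nX-RD)=n(n+\ell-1)(n+\ell)$. Square circuits: - counterclockwise: $[R(XD-n)+\ell+1]\,[(n+1)X-RD]\,[XD+n+\ell+1]\,[(n+\ell)X+RD]=(n+1)(n+\ell)(n+\ell+1)(n+\ell+2)$; - clockwise: $[(n+1)X-RD]\,[R(XD-(n+1))+\ell+1]\,[(n+\ell+2)X+RD]\,(XD+n+\ell)=(n+1)(n+\ell)(n+\ell+1)(n+\ell+2)$.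
   Context: The Weyl algebra is the associative unital $\mathbb C$-algebra generated by $D,X$ with relation $DX-XD=1$ (standard representation: $D$ is differentiation and $X$ multiplication by the variable on $C^\infty(\mathbb R)$). Set $R=X^2-1$. Kernels are taken in the given representation space. A grid here is a diagram of vector spaces indexed by vertices, with operators along arrows; a circuit is a closed path of composable arrows starting and ending at the same vertex, and its circuit endomorphism is the composition of the operators along it (rightmost first). A representation is called SIE (scalar intrinsic endomorphisms) if every circuit endomorphism is a scalar multiple of the identity of the corresponding vertex space. A scalar multiple of the identity is identified with the scalar; all displayed identities are identities of operators restricted to $U_{n\ell}$. *)

(* Defs.v *)
From HB Require Import structures.
From mathcomp Require Import all_boot all_order all_algebra.
From mathcomp Require Import reals complex.

Set Implicit Arguments.
Unset Strict Implicit.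
Unset Printing Implicit Defensive.

Import Order.TTheory GRing.Theory Num.Theory.
Local Open Scope ring_scope.
Local Open Scope complex_scope.

(* By the presentation of the Weyl algebra, a representation on V is a pair of
   endomorphisms of V satisfying the defining relation D X - X D = 1. *)
Record weyl_rep (K : fieldType) (V : lmodType K) := WeylRep {
  wD : {linear V -> V};
  wX : {linear V -> V};
  wDX : forall v, wD (wX v) - wX (wD v) = v
}.

Record grid (K : fieldType) := Grid {
  vertex : Type;
  vspace_at : vertex -> lmodType K;
  arrow : vertex -> vertex -> Type;
  arrow_op : forall a b, arrow a b -> {linear vspace_at a -> vspace_at b}
}.
Arguments vspace_at {K} _ _.
Arguments arrow {K} _ _ _.
Arguments arrow_op {K} _ {a b} _.

Inductive gpath (K : fieldType) (G : grid K) : vertex G -> vertex G -> Type :=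
| gnil a : gpath a a
| gcons a b c of arrow G a b & gpath b c : gpath a c.

Fixpoint path_op (K : fieldType) (G : grid K) (a b : vertex G)
    (p : gpath a b) : vspace_at G a -> vspace_at G b :=
  match p with
  | gnil _ => id
  | gcons _ _ _ e q => path_op q \o arrow_op G e
  end.

Definition circuit (K : fieldType) (G : grid K) (a : vertex G) := gpath a a.

Definition SIE (K : fieldType) (G : grid K) : Prop :=
  forall (a : vertex G) (p : circuit a),
    exists c : K, forall u : vspace_at G a, path_op p u = c *: u.

Section Kernel.
Variables (K : fieldType) (V W : lmodType K).

Definition kerp (f : V -> W) : {pred V} := [pred u | f u == 0].

Lemma kerp_submod_closed (f : {linear V -> W}) : submod_closed (kerp f).
Proof.
split=> [|a u v]; rewrite !inE ?linear0 // => /eqP fu /eqP fv.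
by rewrite linearP fu fv scaler0 addr0.
Qed.

HB.instance Definition _ (f : {linear V -> W}) :=
  GRing.isSubmodClosed.Build K V (kerp f) (kerp_submod_closed f).

Record ker (f : {linear V -> W}) := Ker { kval : V; _ : kval \in kerp f }.

HB.instance Definition _ (f : {linear V -> W}) := [isSub for @kval f].
HB.instance Definition _ (f : {linear V -> W}) := [Choice of ker f by <:].
HB.instance Definition _ (f : {linear V -> W}) :=
  [SubChoice_isSubLmodule of ker f by <:].

End Kernel.

Section Restriction.
Variables (K : fieldType) (V : lmodType K) (f g h : {linear V -> V}).
Hypothesis fgh : {in kerp f, forall u, h u \in kerp g}.

Definition ker_restrict (u : ker f) : ker g := Ker (fgh (valP u)).

Fact ker_restrict_is_linear : linear ker_restrict.
Proof. by move=> a u v; apply: val_inj; rewrite /= !linearP. Qed.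

HB.instance Definition _ :=
  GRing.isLinear.Build K (ker f) (ker g) *:%R ker_restrict
    ker_restrict_is_linear.

End Restriction.

Definition scalar_op (R : realType) (V : lmodType R[i]) (a : R) : V -> V :=
  a%:C \*: idfun.
Arguments scalar_op {R V} a%_R.

HB.instance Definition _ (R : realType) (V : lmodType R[i]) (a : R) :=
  GRing.Linear.on (@scalar_op R V a).

(* In this scope the product of operators is composition, so A * B applies B
   first, and c%:S is multiplication by the real number c. *)
Declare Scope operator_scope.
Delimit Scope operator_scope with op.
Notation "A * B" := (comp A%op B%op) : operator_scope.
Notation "A + B" := (GRing.add_fun A%op B%op) : operator_scope.
Notation "A - B" := (GRing.sub_fun A%op B%op) : operator_scope.
Notation "c %:S" := (scalar_op c%R)
  (at level 2, left associativity, format "c %:S") : operator_scope.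

Definition acts_as (R : realType) (V : lmodType R[i]) (U : {pred V})
    (A : V -> V) (c : R) : Prop :=
  {in U, forall u, A u = c%:C *: u}.
Arguments acts_as {R V} U A%_op c%_R.

Section LegendreGegenbauer.
Local Open Scope operator_scope.
Variables (R : realType) (V : lmodType R[i]) (W : weyl_rep V).
Local Notation D := (wD W).
Local Notation X := (wX W).

Definition Rop : {linear V -> V} := X * X - 1%:S.

Definition Hop (n l : R) : {linear V -> V} :=
  Rop * D * D + (l + 1)%:S * X * D - (n * (n + l))%:S.

Definition LG_space (n l : R) : {pred V} := kerp (Hop n l).

Inductive direction := East | West | North | South | Northwest | Southeast.

Definition LG_op (d : direction) (n l : R) : {linear V -> V} :=
  match d with
  | East => (n + l)%:S * X + Rop * D
  | West => n%:S * X - Rop * D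
  | North => X * D + (n + l)%:S
  | South => Rop * (X * D - n%:S) + (l - 1)%:S
  | Northwest => D
  | Southeast => (l - 1)%:S * X + Rop * D
  end.

Definition LG_target (d : direction) (n l : R) : R * R :=
  match d with
  | East => (n + 1, l)
  | West => (n - 1, l)
  | North => (n, l + 2)
  | South => (n, l - 2)
  | Northwest => (n - 1, l + 2)
  | Southeast => (n + 1, l - 2)
  end%R.

Definition LG_well_defined : Prop :=
  forall d (n l : R), let: (n', l') := LG_target d n l in
  {in LG_space n l, forall u, LG_op d n l u \in LG_space n' l'}.

(* Arrows are tagged by their endpoints through an equation, since for instance
   (n + 1 - 1, l) and (n, l) are equal but not convertible vertices. *)
Definition LG_arrow (a b : R * R) : Type :=
  {d : direction | LG_target d a.1 a.2 == b}.

Fact LG_arrow_stable (wd : LG_well_defined) a b (e : LG_arrow a b) :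
  {in kerp (Hop a.1 a.2), forall u,
     LG_op (sval e) a.1 a.2 u \in kerp (Hop b.1 b.2)}.
Proof.
case: e => d /= /eqP <- u Uu.
by have := wd d a.1 a.2; case: LG_target => n' l' /(_ u Uu).
Qed.

Definition LG_grid (wd : LG_well_defined) : grid R[i] := {|
  vertex := (R * R)%type;
  vspace_at a := ker (Hop a.1 a.2);
  arrow := LG_arrow;
  arrow_op a b e := ker_restrict (LG_arrow_stable wd e)
|}.

End LegendreGegenbauer.
Arguments Hop {R V} W n%_R l%_R.
Arguments LG_space {R V} W n%_R l%_R.

(* Main.v *)
(* Let u be a solution of H u = 0.  Since R D^2 u is a combination of X D u and
   u, every element v obtained from u by D and X satisfies
   R^k v = p(X) u + q(X) D u for some k and explicit polynomials p and q; as R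
   is injective, identities between operators on U_{n,l} become polynomial
   identities in X.  This gives that H kills the images of the arrows, and
   that two consecutive arrows compose to a scalar multiple of
   - the identity, if their directions are opposite;
   - the arrow in between, if their directions are 120 degrees apart in the
     triangular lattice;
   - the composition in the other order, if their directions are neighbours,
     {East, Southeast} and {West, Northwest} excepted.
   A shortest window d f_1 ... f_r e of a path such that d and e are neither
   equal nor neighbours has all the f_i equal to the direction between d and e
   (and r = 0 if d and e are opposite), and at least one of d and e commutes
   with it, so the path is a multiple of a shorter one.  A path without such
   windows points into a half-plane and can only be a circuit if it is
   empty. *)
Require Import Defs.
From HB Require Import structures.
From mathcomp Require Import all_boot all_order all_algebra.
From mathcomp Require Import reals complex.
From mathcomp Require Import ring lra.

Set Implicit Arguments.
Unset Strict Implicit.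
Unset Printing Implicit Defensive.

Import Order.TTheory GRing.Theory Num.Theory.
Local Open Scope ring_scope.
Local Open Scope complex_scope.

(** * Action of polynomials in X *)

Section PolynomialAction.
Variables (RR : realType) (V : lmodType RR[i]) (W : weyl_rep V).
Local Notation D := (wD W).
Local Notation X := (wX W).
Implicit Types (p q : {poly RR}) (c : RR) (v w : V).

(** This is p(X) v. Real coefficients suffice because n and l are real, and identities between
    operators become goals for [ring] in [{poly RR}]. *)
Definition pact p v : V := \sum_(i < size p) (p`_i)%:C *: iter i X v.

Lemma pact_wide m p v :
  (size p <= m)%N -> pact p v = \sum_(i < m) (p`_i)%:C *: iter i X v.
Proof.
move=> le_pm; rewrite /pact.
rewrite (big_ord_widen m (fun i => (p`_i)%:C *: iter i X v)) //.
rewrite big_mkcond; apply: eq_bigr => i _.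
by case: ltnP => // /(nth_default 0)->; rewrite scale0r.
Qed.

Lemma pactDl p q v : pact (p + q) v = pact p v + pact q v.
Proof.
pose m := maxn (size p) (size q).
rewrite (@pact_wide m (p + q)) ?(leq_trans (size_polyD _ _)) //.
rewrite (@pact_wide m p) ?leq_maxl // (@pact_wide m q) ?leq_maxr //.
rewrite -big_split; apply: eq_bigr => i _.
by rewrite coefD rmorphD scalerDl.
Qed.

Lemma pactC c v : pact c%:P v = c%:C *: v.
Proof. by rewrite (@pact_wide 1) ?size_polyC ?leq_b1 // big_ord1 coefC. Qed.

Lemma pactXl p v : pact (p * 'X) v = X (pact p v).
Proof.
have [->|p0] := eqVneq p 0.
  by rewrite mul0r /pact size_poly0 !big_ord0 linear0.
rewrite /pact size_mulX // big_ord_recl coefMX scale0r add0r linear_sum.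
by apply: eq_bigr => i _; rewrite linearZ lift0 coefMX.
Qed.

Lemma iter_linearP i a v w :
  iter i X (a *: v + w) = a *: iter i X v + iter i X w.
Proof. by elim: i => //= i ->; rewrite linearP. Qed.

Lemma pact_is_linear p : linear (pact p).
Proof.
move=> a v w; rewrite /pact scaler_sumr -big_split; apply: eq_bigr => i _ /=.
by rewrite iter_linearP scalerDr !scalerA mulrC.
Qed.

HB.instance Definition _ p :=
  GRing.isLinear.Build RR[i] V V *:%R (pact p) (pact_is_linear p).

Lemma pact0l v : pact 0 v = 0.
Proof. by rewrite /pact size_poly0 big_ord0. Qed.

Lemma pact1l v : pact 1 v = v.
Proof. by rewrite pactC scale1r. Qed.

Lemma pactX v : pact 'X v = X v.
Proof. by rewrite -['X]mul1r pactXl pact1l. Qed.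

Lemma pactM p q v : pact (p * q) v = pact p (pact q v).
Proof.
have CM c r : pact (c%:P * r) v = c%:C *: pact r v.
  elim/poly_ind: r c => [|r d IH] c; first by rewrite mulr0 pact0l scaler0.
  rewrite mulrDr mulrA -polyCM !pactDl !pactXl IH linearZ !pactC rmorphM.
  by rewrite scalerDr scalerA.
elim/poly_ind: p => [|p c IH]; first by rewrite mul0r !pact0l.
by rewrite mulrDl !pactDl CM pactC -mulrA ['X * q]mulrC mulrA !pactXl IH.
Qed.

Lemma pactNl p v : pact (- p) v = - pact p v.
Proof. by apply: (addIr (pact p v)); rewrite -pactDl !addNr pact0l. Qed.

Lemma Rop_pact v : Rop W v = pact ('X * 'X - 1) v.
Proof.
rewrite pactDl pactNl pactM !pactX pact1l /Rop /= /GRing.sub_fun /=.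
by rewrite /scalar_op /= scale1r.
Qed.

(** The commutator of D with p(X) is p'(X); this follows from DX = XD + 1 by induction on p. *)
Lemma wD_pact p v : D (pact p v) = pact p^`() v + pact p (D v).
Proof.
elim/poly_ind: p => [|p c IH].
  by rewrite deriv0 !pact0l linear0 addr0.
rewrite derivD derivC addr0 derivM derivX mulr1 !pactDl !pactXl !pactC.
rewrite linearD linearZ /=.
have ->: D (X (pact p v)) = pact p v + X (D (pact p v)).
  by rewrite -{2}(wDX W (pact p v)) subrK.
rewrite IH linearD /=.
by rewrite -!addrA addrCA !addrA.
Qed.

Hypothesis R_inj : injective (Rop W).

Local Notation Rp := ('X * 'X - 1 : {poly RR}).

Lemma pact_Rp_inj k : injective (pact (Rp ^+ k)).
Proof.
elim: k => [|k IH] v w; first by rewrite !pact1l.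
by rewrite exprS !pactM -!Rop_pact => /R_inj /IH.
Qed.

Definition comb (a b : {poly RR}) (x y : {poly RR} * {poly RR}) :=
  (a * x.1 + b * y.1, a * x.2 + b * y.2).

(* Words list the arrows in the order of application.  Neighbouring directions
   commute, except for the pairs {East, Southeast} and {West, Northwest}, which
   only commute up to a ratio of scalars that may vanish, and are therefore
   left alone. *)
Definition reduct d e : seq direction :=
  match d, e with
  | East, West | West, East | North, South | South, North
  | Northwest, Southeast | Southeast, Northwest => [::]
  | Northwest, East | East, Northwest => [:: North]
  | North, West | West, North => [:: Northwest]
  | Northwest, South | South, Northwest => [:: West]
  | West, Southeast | Southeast, West => [:: South]
  | East, South | South, East => [:: Southeast]
  | North, Southeast | Southeast, North => [:: East]
  | East, Southeast | Southeast, East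
  | West, Northwest | Northwest, West => [:: d; e]
  | _, _ => [:: e; d]
  end.

Definition reduct_coef d e (n l : RR) : RR :=
  match d, e with
  | East, West => (n + 1) * (n + l)
  | West, East => n * (n + l - 1)
  | North, South => (n + l) * (n + l + 1)
  | South, North => (n + l - 2) * (n + l - 1)
  | Northwest, Southeast => n * (n + l)
  | Southeast, Northwest => (n + 1) * (n + l - 1)
  | Northwest, East => n
  | East, Northwest => n + 1
  | North, West => n + l + 1
  | West, North => n + l - 1
  | Northwest, South => n + l
  | South, Northwest => n + l - 2
  | West, Southeast => n
  | Southeast, West => n + 1
  | East, South => n + l
  | South, East => n + l - 2
  | North, Southeast => n + l + 1
  | Southeast, North => n + l - 1
  | _, _ => 1
  end.

Definition word_target (a : RR * RR) (w : seq direction) : RR * RR :=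
  foldl (fun b d => LG_target d b.1 b.2) a w.

Fixpoint word_op (a : RR * RR) (w : seq direction) (v : V) : V :=
  if w is d :: w' then word_op (LG_target d a.1 a.2) w' (LG_op W d a.1 a.2 v)
  else v.

(** * Normal forms over a solution u of H u = 0 *)

Section NormalForm.
Variables (n l : RR) (u : V).
Hypothesis Uu : u \in LG_space W n l.

Definition nf (x : {poly RR} * {poly RR}) : V := pact x.1 u + pact x.2 (D u).

Lemma nf_comb a b x y : pact a (nf x) + pact b (nf y) = nf (comb a b x y).
Proof. by rewrite /nf !linearD /= !pactDl -!pactM addrACA. Qed.

(** The power of R acts as a denominator: the equation expresses R D^2 u, not D^2 u, through u and D
    u, so each further derivative costs one factor R. *)
Definition nform k v x := pact (Rp ^+ k) v = nf x.

Lemma nform_inj k v w x : nform k v x -> nform k w x -> v = w.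
Proof. by rewrite /nform => <- /pact_Rp_inj. Qed.

Lemma nform_comb k v w x y a b :
  nform k v x -> nform k w y -> nform k (pact a v + pact b w) (comb a b x y).
Proof.
rewrite /nform -nf_comb => <- <-.
by rewrite linearD /= -!pactM [_ * a]mulrC [_ * b]mulrC.
Qed.

Lemma nform_up k v x : nform k v x -> nform k.+1 v (comb Rp 0 x x).
Proof. by rewrite /nform exprS pactM -nf_comb pact0l addr0 => ->. Qed.

Lemma Hop_kernel :
  pact Rp (D (D u)) = nf ((n * (n + l))%:P, - ((l + 1)%:P * 'X)).
Proof.
have: Rop W (D (D u)) + (l + 1)%:C *: X (D u) - (n * (n + l))%:C *: u = 0.
  by move: Uu; rewrite inE => /eqP.
move=> /(canRL (subrK _)); rewrite add0r => /(canRL (addrK _)).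
by rewrite Rop_pact => ->; rewrite /nf pactNl pactM !pactC pactX.
Qed.

(* From R^(k+1) D v = R D (R^k v) - 2 k X R^k v. *)
Definition dform k (x : {poly RR} * {poly RR}) :=
  (Rp * x.1^`() + (n * (n + l))%:P * x.2 - k%:R%:P * 'X *+ 2 * x.1,
   Rp * x.1 + Rp * x.2^`() - (l + 1)%:P * 'X * x.2 - k%:R%:P * 'X *+ 2 * x.2).

Lemma mul_deriv_Rp_exp k :
  Rp * (Rp ^+ k)^`() = k%:R%:P * 'X *+ 2 * Rp ^+ k.
Proof.
rewrite deriv_exp; case: k => [|k].
  by rewrite mulr0n polyC0 !mul0r mulr0 mul0rn mul0r.
by rewrite derivB derivM derivX derivC /= -mulr_natr polyC_natr exprS; ring.
Qed.

Lemma nf_D x : pact Rp (D (nf x)) = nf (dform 0 x).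
Proof.
rewrite /nf linearD /= !wD_pact !linearD /= -(pactM Rp x.2) [Rp * x.2]mulrC.
rewrite pactM Hop_kernel /nf linearD /= -!pactM !addrA.
rewrite [RHS]/= polyC0 !mul0r mul0rn !mul0r !subr0.
rewrite (mulrC _ x.2) !(pactDl _ _ u) !(pactDl _ _ (D u)) mulrN (mulrC _ x.2).
by rewrite [RHS]addrACA !addrA.
Qed.

Lemma nform_D k v x : nform k v x -> nform k.+1 (D v) (dform k x).
Proof.
rewrite /nform => h; have := nf_D x.
rewrite -h wD_pact linearD /= -!pactM mul_deriv_Rp_exp -exprS pactM h.
move=> /(canRL (addKr _)) ->.
rewrite -pactNl -[nf (dform 0 x)]pact1l nf_comb; congr nf.
by rewrite /comb /dform /=; congr (_, _); rewrite polyC0; ring.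
Qed.

Definition op_coef d (m j : RR) : {poly RR} * {poly RR} :=
  match d with
  | East => ((m + j)%:P * 'X, Rp)
  | West => (m%:P * 'X, - Rp)
  | North => ((m + j)%:P, 'X)
  | South => ((j - 1)%:P - m%:P * Rp, Rp * 'X)
  | Northwest => (0, 1)
  | Southeast => ((j - 1)%:P * 'X, Rp)
  end.

Lemma LG_opE d m j v :
  LG_op W d m j v = pact (op_coef d m j).1 v + pact (op_coef d m j).2 (D v).
Proof.
have RB w w' : Rop W (w - w') = Rop W w - Rop W w' by exact: linearB.
have RZ (c : RR[i]) w : Rop W (c *: w) = c *: Rop W w by exact: linearZ.
have RpE w : pact Rp w = Rop W w by rewrite Rop_pact.
case: d; rewrite [op_coef _ _ _]/=.
- by rewrite pactM RpE pactC pactX.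
- by rewrite pactM pactNl RpE pactC pactX.
- by rewrite pactC pactX addrC.
- transitivity (Rop W (X (D v) - m%:C *: v) + (j - 1)%:C *: v) => //.
  rewrite RB RZ pactDl pactNl !pactM !RpE pactX !pactC.
  by rewrite addrC addrCA addrC.
- by rewrite -[RHS]/(pact 0 v + pact 1 (D v)) pact0l pact1l add0r.
- by rewrite pactM RpE pactC pactX.
Qed.

(** The term [comb Rp 0 x x] is x multiplied by R, which brings v to the exponent at which D v is
    expressed. *)
Definition oform k x d m j :=
  let c := op_coef d m j in comb c.1 c.2 (comb Rp 0 x x) (dform k x).

Lemma nform_LG_op k v x d m j :
  nform k v x -> nform k.+1 (LG_op W d m j v) (oform k x d m j).
Proof.
by move=> h; rewrite LG_opE; apply: nform_comb (nform_up h) (nform_D h).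
Qed.

Lemma nform_LG_op_base d : nform 0 (LG_op W d n l u) (op_coef d n l).
Proof. by rewrite /nform expr0 pact1l LG_opE. Qed.

(** Two derivatives raise the exponent by two, but the leading R of H absorbs one of these
    factors. *)
Lemma nform_Hop k v x m j : nform k v x ->
  nform k.+1 (Hop W m j v)
    (comb 1 1 (dform k.+1 (dform k x))
       (comb ((j + 1)%:P * 'X) (- (m * (m + j))%:P)
          (dform k x) (comb Rp 0 x x))).
Proof.
move=> h.
have ->: Hop W m j v = pact 1 (Rop W (D (D v))) +
    pact 1 (pact ((j + 1)%:P * 'X) (D v) + pact (- (m * (m + j))%:P) v).
  by rewrite !pact1l pactNl pactM !pactC pactX addrA.
apply: nform_comb; last exact: nform_comb (nform_D h) (nform_up h).
by have := nform_D (nform_D h); rewrite /nform exprSr pactM -Rop_pact.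
Qed.

(** At exponent 1, the image of u under the arrow and then under H at the target has a pair whose
    two polynomials vanish identically, and R can be cancelled. *)
Lemma LG_op_stable d : let: (n', l') := LG_target d n l in
  LG_op W d n l u \in LG_space W n' l'.
Proof.
pose t := LG_target d n l.
suff: Hop W t.1 t.2 (LG_op W d n l u) = 0.
  by rewrite /t; case: LG_target => ? ? /= e; rewrite inE; apply/eqP.
apply: (@nform_inj 1 _ _ (0, 0)); last first.
  by rewrite /nform /nf linear0 /= !pact0l addr0.
have := nform_Hop t.1 t.2 (nform_LG_op_base d).
rewrite /t; congr nform.
case: d {t}; rewrite /oform /comb /dform /=; congr (_, _);
  rewrite ?polyC0 !(derivE, deriv0) /=; ring.
Qed.

Lemma word_op_reduct d e :
  word_op (n, l) [:: d; e] u =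
  (reduct_coef d e n l)%:C *: word_op (n, l) (reduct d e) u.
Proof.
(* Two arrows yield a normal form at exponent 1. A reduct of length 0 or 1 starts at exponent 0, so
   its pair is first multiplied by R; a reduct of length 2 is compared directly. *)
have red0 c x : nform 1 x (comb Rp 0 (c%:P, 0) (c%:P, 0)) -> x = c%:C *: u.
  move=> hx; apply: nform_inj hx (nform_up _).
  by rewrite /nform /nf expr0 pact1l pactC pact0l addr0.
have red1 c m x :
    nform 1 x (comb (c%:P * Rp) 0 (op_coef m n l) (op_coef m n l)) ->
  x = c%:C *: LG_op W m n l u.
  move=> hx; apply: nform_inj hx _.
  have hm := nform_up (nform_LG_op_base m).
  have := nform_comb c%:P 0 hm hm; rewrite pact0l addr0 pactC; congr nform.
  by rewrite /comb /=; congr (_, _); ring.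
have red2 b m m' x : nform 1 x (oform 0 (op_coef m n l) m' b.1 b.2) ->
    x = 1 *: LG_op W m' b.1 b.2 (LG_op W m n l u).
  move=> hx; rewrite scale1r; apply: nform_inj hx _.
  exact: nform_LG_op (nform_LG_op_base m).
pose t := LG_target d n l.
have := nform_LG_op e t.1 t.2 (nform_LG_op_base d); rewrite {}/t.
case: d; case: e => h; (apply: red0 || apply: red1 || apply: red2);
  move: h; congr nform;
  rewrite /oform /comb /dform /=; congr (_, _);
  rewrite ?polyC0 !(derivE, deriv0) /=; ring.
Qed.

End NormalForm.

End PolynomialAction.

(** * Rewriting words of arrows up to scalars *)

Section Grid.
Variables (RR : realType) (V : lmodType RR[i]) (W : weyl_rep V).
Hypothesis R_inj : injective (Rop W).
Implicit Types (d e : direction) (p q w x y : seq direction) (a b : RR * RR).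

(** Equivalently, the directions are equal or 60 degrees apart; all other pairs lose a letter under
    [reduct]. *)
Definition adjacent d e := (1 < size (reduct d e))%N.

Definition commuting d e :=
  match d, e with
  | East, Southeast | Southeast, East
  | West, Northwest | Northwest, West => false
  | _, _ => adjacent d e
  end.

Lemma LG_op_wd : LG_well_defined W.
Proof.
move=> d n l; case E: (LG_target d n l) => [n' l'] u Uu.
by have := LG_op_stable R_inj Uu d; rewrite E.
Qed.

Lemma LG_op_mem d a u : u \in LG_space W a.1 a.2 ->
  LG_op W d a.1 a.2 u \in
    LG_space W (LG_target d a.1 a.2).1 (LG_target d a.1 a.2).2.
Proof. by move=> Uu; have := LG_op_stable R_inj Uu d; case: LG_target. Qed.

Lemma word_op_linear a w : linear (word_op W a w).
Proof. by elim: w a => //= d w IH a c u v; rewrite linearP IH. Qed.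

HB.instance Definition _ a w :=
  GRing.isLinear.Build RR[i] V V *:%R (word_op W a w) (word_op_linear a w).

Lemma word_op_cat a p q v :
  word_op W a (p ++ q) v = word_op W (word_target a p) q (word_op W a p v).
Proof. by elim: p a v => /=. Qed.

Lemma word_op_reduct_cat a d e w u : u \in LG_space W a.1 a.2 ->
  word_op W a (d :: e :: w) u =
  (reduct_coef d e a.1 a.2)%:C *: word_op W a (reduct d e ++ w) u.
Proof.
case: a => n l Uu; rewrite -cat1s -[e :: w]cat1s catA word_op_cat.
rewrite (word_op_reduct R_inj Uu) linearZ word_op_cat /=.
congr (_ *: word_op _ _ _ _).
(* Both sides continue along [w] from the same vertex, because a reduct has the same total
   displacement as the pair it replaces. *)
by case: d; case: e; congr (_, _) => /=; ring.
Qed.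

(** This is a preorder rather than an equivalence: the scalar may vanish, so only the first word is
    known to be a multiple of the second. *)
Definition sim w w' := forall a,
  word_target a w = word_target a w' /\
  exists c : RR, {in LG_space W a.1 a.2, forall u,
    word_op W a w u = c%:C *: word_op W a w' u}.

Lemma sim_refl w : sim w w.
Proof. by move=> a; split=> //; exists 1 => u _; rewrite scale1r. Qed.

Lemma sim_trans y x w : sim x y -> sim y w -> sim x w.
Proof.
move=> xy yw a; have [-> [c Ec]] := xy a; have [-> [c' Ec']] := yw a.
by split=> //; exists (c * c') => u Uu; rewrite Ec ?Ec' // scalerA rmorphM.
Qed.

(** The scalar passes through the suffix by linearity; the prefix is harmless because arrows send
    solution spaces to solution spaces. *)
Lemma sim_cat x w w' y : sim w w' -> sim (x ++ w ++ y) (x ++ w' ++ y).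
Proof.
move=> ww'; elim: x => [|d x IH] a /=.
  have [Et [c Ec]] := ww' a; rewrite /word_target !foldl_cat.
  rewrite -!/(word_target a _) Et; split=> //; exists c => u Uu.
  by rewrite !word_op_cat Et Ec // linearZ.
have [Et [c Ec]] := IH (LG_target d a.1 a.2).
by split=> //; exists c => u Uu; rewrite Ec ?LG_op_mem.
Qed.

Lemma sim_reduct d e : sim [:: d; e] (reduct d e).
Proof.
move=> a; split; last first.
  exists (reduct_coef d e a.1 a.2) => u Uu.
  by rewrite word_op_reduct_cat // cats0.
by case: a => n l; case: d; case: e; congr (_, _) => /=; ring.
Qed.

Lemma sim_commuting d e : commuting d e -> sim [:: d; e] [:: e; d].
Proof. by have := sim_reduct d e; case: d; case: e. Qed.

Lemma sim_move_right d p : all (commuting d) p -> sim (d :: p) (rcons p d).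
Proof.
elim: p => [|e p IH] /=; first by move=> _; apply: sim_refl.
move=> /andP[de dp].
apply: (sim_trans (sim_cat [::] p (sim_commuting de))).
by have := sim_cat [:: e] [::] (IH dp); rewrite !cats0.
Qed.

Lemma sim_move_left e p : all (commuting^~ e) p -> sim (rcons p e) (e :: p).
Proof.
elim: p => [|d p IH] /=; first by move=> _; apply: sim_refl.
move=> /andP[de dp].
have := sim_cat [:: d] [::] (IH dp); rewrite !cats0 => /sim_trans; apply.
exact: (sim_cat [::] p (sim_commuting de)).
Qed.

(** Opposite directions leave no f. At 120 degrees f is the direction in between, and it belongs to
    at most one of the two excluded pairs, since these are disjoint. *)
Lemma commuting_side d e : ~~ adjacent d e ->
  (forall f, adjacent d f && adjacent f e -> commuting d f) \/
  (forall f, adjacent d f && adjacent f e -> commuting f e).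
Proof. by case: d; case: e => // _; (left; by case) || (right; by case). Qed.

Lemma sim_window d p e : ~~ adjacent d e ->
    all (fun f => adjacent d f && adjacent f e) p ->
  exists2 w, (size w < (size p).+2)%N & sim (d :: rcons p e) w.
Proof.
move=> nde dpe; have short : (size (reduct d e) < 2)%N by rewrite ltnNge.
have [dp|pe] := commuting_side nde.
- exists (p ++ reduct d e).
    by rewrite size_cat -addn2 ltn_add2l.
  rewrite -cat1s -cats1 catA.
  apply: (@sim_trans (p ++ [:: d; e])).
    have := sim_cat [::] [:: e] (sim_move_right (sub_all dp dpe)).
    by rewrite /= -cats1 -catA.
  by have := sim_cat p [::] (sim_reduct d e); rewrite !cats0.
exists (reduct d e ++ p); first by rewrite size_cat -add2n ltn_add2r.
apply: (@sim_trans ([:: d; e] ++ p)).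
  have := sim_cat [:: d] [::] (sim_move_left (sub_all pe dpe)).
  by rewrite !cats0.
exact: (sim_cat [::] p (sim_reduct d e)).
Qed.

Lemma adjacent_or_shorter w :
  pairwise adjacent w \/ exists2 w', (size w' < size w)%N & sim w w'.
Proof.
elim: w => [|d w [good|[w' lt_w' sim_w']]]; first by left.
- have [adj|] := boolP (all (adjacent d) w); first by left; rewrite /= adj.
  (* Let e be the first letter not adjacent to d. The letters p before it are adjacent to d by
     minimality, and to e because the tail is pairwise adjacent. *)
  rewrite -has_predC => /split_find split_w; move: split_w good.
  case=> e p y /= nde np good; right.
  have dp : all (adjacent d) p by rewrite -[all _ _]negbK -has_predC.
  have pe : all (adjacent^~ e) p.
    move: good; rewrite cat_rcons pairwise_cat allrel_consr.
    by case/andP=> /andP[].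
  have [||v lt_v sim_v] := @sim_window d p e; first exact: nde.
    by rewrite all_predI dp.
  exists (v ++ y).
    by rewrite /= !size_cat size_rcons -[X in (_ < X)%N]addSn ltn_add2r.
  exact: (sim_cat [::] y sim_v).
right; exists (d :: w'); first exact: lt_w'.
by have := sim_cat [:: d] [::] sim_w'; rewrite !cats0.
Qed.

Lemma sim_adjacent w : exists2 w', pairwise adjacent w' & sim w w'.
Proof.
have [k] := ubnP (size w); elim: k w => // k IH w lt_wk.
have [good|[v lt_vw sim_v]] := adjacent_or_shorter w.
  by exists w => //; apply: sim_refl.
have [w' good sim_w'] := IH v (leq_trans lt_vw lt_wk).
by exists w' => //; apply: sim_trans sim_w'.
Qed.

(* The six directions are the roots of an A2 system; in the basis given by
   (n, l) this is their inner product with [d], up to a positive factor. *)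
Definition height d b : RR :=
  let t := LG_target d 0 0 in
  4 * t.1 * b.1 + t.1 * b.2 + t.2 * b.1 + t.2 * b.2.

(** Roots at an angle of at most 60 degrees have positive inner product. *)
Lemma height_target d e b :
  adjacent d e -> height d b < height d (LG_target e b.1 b.2).
Proof.
by case: d; case: e => // _; case: b => n l; rewrite /height /=; lra.
Qed.

Lemma height_word_target d b w :
  all (adjacent d) w -> height d b <= height d (word_target b w).
Proof.
elim: w b => //= e w IH b /andP[de dw].
by rewrite (le_trans (ltW (height_target b de))) ?IH.
Qed.

(** Measured along the first letter, the height grows strictly at the first step and never drops
    afterwards, so a nonempty word cannot return. *)
Lemma adjacent_circuit w a :
  pairwise adjacent w -> word_target a w = a -> w = [::].
Proof.
case: w => //= d w /andP[dw _] Ea.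
have := height_word_target (LG_target d a.1 a.2) dw.
by rewrite [word_target _ _]Ea leNgt height_target //; case: (d).
Qed.

(** * Circuits of the grid *)

Lemma circuit_scalar w a : word_target a w = a ->
  exists c : RR, {in LG_space W a.1 a.2, forall u, word_op W a w u = c%:C *: u}.
Proof.
move=> Ea; have [w' good /(_ a)[Et [c Ec]]] := sim_adjacent w.
exists c => u Uu; rewrite Ec //.
by rewrite (@adjacent_circuit w' a) // -Et.
Qed.

(** Forgetting the intermediate vertices turns dependently typed paths into lists, to which the
    rewriting applies. *)
Lemma gpath_word (a b : vertex (LG_grid LG_op_wd)) (p : gpath a b) :
  exists2 w, word_target a w = b &
    forall u, kval (path_op p u) = word_op W a w (kval u).
Proof.
elim: p => {a b} [a|a b c [d /= Ed] p [w Et Ew]]; first by exists [::].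
by move/eqP: (Ed) => Eb; exists (d :: w); rewrite /= Eb.
Qed.

Lemma LG_grid_SIE : SIE (LG_grid LG_op_wd).
Proof.
move=> a p; have [w Ea Ew] := gpath_word p.
have [c Ec] := circuit_scalar Ea; exists c%:C => u.
by apply: val_inj; rewrite /= Ew Ec //; exact: (valP u).
Qed.

(** * Evaluation of the listed circuits *)

Lemma acts_as_nil a : acts_as (LG_space W a.1 a.2) (word_op W a [::]) 1.
Proof. by move=> u _; rewrite scale1r. Qed.

(** The scalar is related to [c'] by a separate equation, so that [c'] can be found by unification
    and the final identity left to [ring]. *)
Lemma acts_as_reduct a d e w c c' :
    acts_as (LG_space W a.1 a.2) (word_op W a (reduct d e ++ w)) c' ->
    c = reduct_coef d e a.1 a.2 * c' ->
  acts_as (LG_space W a.1 a.2) (word_op W a (d :: e :: w)) c.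
Proof.
by move=> h -> u Uu; rewrite word_op_reduct_cat // h // scalerA rmorphM.
Qed.

(** A square circuit starts with two neighbouring directions, which do not shorten, so its reduction
    begins behind the first letter. *)
Lemma acts_as_cons_reduct a f d e w c c' (b := LG_target f a.1 a.2) :
    acts_as (LG_space W a.1 a.2) (word_op W a (f :: reduct d e ++ w)) c' ->
    c = reduct_coef d e b.1 b.2 * c' ->
  acts_as (LG_space W a.1 a.2) (word_op W a (f :: d :: e :: w)) c.
Proof.
move=> h -> u Uu; rewrite -cat1s word_op_cat word_op_reduct_cat ?LG_op_mem //.
by rewrite -[word_op W b _ _]/(word_op W a (f :: _) u) h // scalerA rmorphM.
Qed.

Lemma eq_acts_as (U : {pred V}) (A B : V -> V) (c : RR) :
  A =1 B -> acts_as U B c -> acts_as U A c.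
Proof. by move=> AB h u Uu; rewrite AB h. Qed.

End Grid.

Theorem theorem6 (RR : realType) (V : lmodType RR[i]) (W : weyl_rep V)
  (X2_inj : injective (wX W * wX W)%op)
  (R_inj : injective (Rop W)) :
  (exists wd : LG_well_defined W, SIE (LG_grid wd)) /\
  (forall n l : RR,
   let D := wD W in
   let X := wX W in
   let R := Rop W in
   let U := LG_space W n l in
   (* narrow circuits *)
   (acts_as U (((n + 1)%:S * X - R * D) * ((n + l)%:S * X + R * D))
       ((n + 1) * (n + l)) /\
     acts_as U (((n + l - 1)%:S * X + R * D) * (n%:S * X - R * D))
       (n * (n + l - 1)) /\
     acts_as U ((R * (X * D - n%:S) + (l + 1)%:S) * (X * D + (n + l)%:S))
       ((n + l) * (n + l + 1)) /\
     acts_as U ((X * D + (n + l - 2)%:S) * (R * (X * D - n%:S) + (l - 1)%:S))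
       ((n + l - 2) * (n + l - 1)) /\
     acts_as U (((l + 1)%:S * X + R * D) * D)
       (n * (n + l)) /\
     acts_as U (D * ((l - 1)%:S * X + R * D))
       ((n + 1) * (n + l - 1))) /\
   (* triangle circuits *)
   (acts_as U (((l + 1)%:S * X + R * D) * (n%:S * X - R * D) * (X * D + (n + l)%:S))
       (n * (n + l) * (n + l + 1)) /\
     acts_as U ((R * (X * D - n%:S) + (l + 1)%:S) * ((n + l + 1)%:S * X + R * D) * D)
       (n * (n + l) * (n + l + 1)) /\
     acts_as U (((n + l - 1)%:S * X + R * D)
                * (R * (X * D - n%:S + 1%:S) + (l + 1)%:S) * D)
       (n * (n + l - 1) * (n + l)) /\
     acts_as U (((l + 1)%:S * X + R * D) * (X * D + (n + l - 1)%:S)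
                * (n%:S * X - R * D))
       (n * (n + l - 1) * (n + l))) /\
   (* square circuits *)
   (acts_as U ((R * (X * D - n%:S) + (l + 1)%:S) * ((n + 1)%:S * X - R * D)
                * (X * D + (n + l + 1)%:S) * ((n + l)%:S * X + R * D))
       ((n + 1) * (n + l) * (n + l + 1) * (n + l + 2)) /\
     acts_as U (((n + 1)%:S * X - R * D) * (R * (X * D - (n + 1)%:S) + (l + 1)%:S)
                * ((n + l + 2)%:S * X + R * D) * (X * D + (n + l)%:S))
       ((n + 1) * (n + l) * (n + l + 1) * (n + l + 2)))).
Proof.
split; first by exists (LG_op_wd R_inj); apply: LG_grid_SIE.
move=> n l; cbv zeta.
(* Moving along a word shifts n and l; these identities bring the shifted parameters to the form
   used in the stated operators. *)
have e1 : l + 2 - 1 = l + 1 by ring.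
have e2 : n - 1 + l = n + l - 1 by ring.
have e3 : n + (l - 2) = n + l - 2 by ring.
have e4 : n - 1 + (l + 2) = n + l + 1 by ring.
have e5 : n + 1 + l = n + l + 1 by ring.
have e6 : n + (l + 2) = n + l + 2 by ring.
have e7 : n - 1 + 1 = n by ring.
have e8 : n + 1 - 1 = n by ring.
have e9 : l + 2 - 2 = l by ring.
(* The South arrow after Northwest carries the parameter n - 1, which the stated circuit splits into
   two terms. *)
have eS v : wX W (wD W v) - n%:S%op v + 1%:S%op v =
    wX W (wD W v) - (n - 1)%:S%op v.
  by rewrite /scalar_op /= rmorphB scalerBl opprB addrA addrAC.
have step := @acts_as_reduct _ _ W R_inj (n, l).
have step1 := @acts_as_cons_reduct _ _ W R_inj (n, l).
split; [do 5?split | split; [do 3?split | split]].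
- apply: (eq_acts_as (B := word_op W (n, l) [:: East; West])) => [v|].
    by [].
  by eapply step; [exact: acts_as_nil | rewrite /=; ring].
- apply: (eq_acts_as (B := word_op W (n, l) [:: West; East])) => [v|].
    by rewrite /= e2.
  by eapply step; [exact: acts_as_nil | rewrite /=; ring].
- apply: (eq_acts_as (B := word_op W (n, l) [:: North; South])) => [v|].
    by rewrite /= e1.
  by eapply step; [exact: acts_as_nil | rewrite /=; ring].
- apply: (eq_acts_as (B := word_op W (n, l) [:: South; North])) => [v|].
    by rewrite /= e3.
  by eapply step; [exact: acts_as_nil | rewrite /=; ring].
- apply: (eq_acts_as (B := word_op W (n, l) [:: Northwest; Southeast])) => [v|].
    by rewrite /= e1.
  by eapply step; [exact: acts_as_nil | rewrite /=; ring].
- apply: (eq_acts_as (B := word_op W (n, l) [:: Southeast; Northwest])) => [v|].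
    by [].
  by eapply step; [exact: acts_as_nil | rewrite /=; ring].
- apply: (eq_acts_as (B := word_op W (n, l) [:: North; West; Southeast])) => [v|].
    by rewrite /= e1.
  eapply step; [eapply step; [exact: acts_as_nil | reflexivity] |].
  by rewrite /=; ring.
- apply: (eq_acts_as (B := word_op W (n, l) [:: Northwest; East; South])) => [v|].
    by rewrite /= e1 e4 e7.
  eapply step; [eapply step; [exact: acts_as_nil | reflexivity] |].
  by rewrite /=; ring.
- apply: (eq_acts_as (B := word_op W (n, l) [:: Northwest; South; East])) => [v|].
    by rewrite /= e1 e9 e2 eS.
  eapply step; [eapply step; [exact: acts_as_nil | reflexivity] |].
  by rewrite /=; ring.
- apply: (eq_acts_as (B := word_op W (n, l) [:: West; North; Southeast])) => [v|].
    by rewrite /= e1 e2.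
  eapply step; [eapply step; [exact: acts_as_nil | reflexivity] |].
  by rewrite /=; ring.
- apply: (eq_acts_as (B := word_op W (n, l) [:: East; North; West; South])) => [v|].
    by rewrite /= e1 e5 e8.
  (* North, West becomes Northwest; Northwest, South becomes West; East, West then cancels. *)
  eapply step1; [eapply step1; [eapply step |] |]; try reflexivity.
    exact: acts_as_nil.
  by rewrite /=; ring.
- apply: (eq_acts_as (B := word_op W (n, l) [:: North; East; South; West])) => [v|].
    by rewrite /= e1 e6.
  (* East, South becomes Southeast; North, Southeast becomes East; East, West then cancels. *)
  eapply step1; [eapply step; [eapply step |] |]; try reflexivity.
    exact: acts_as_nil.
  by rewrite /=; ring.
Qed.
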